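(* For every $k\ge 5$ there exists an edge-ordered graph $G_k$ whose underlying graph is the complete graph $K_k$ such that \[sat_e(n,e_0+G_k+e_{\max})=\Omega(n\sqrt{\log n}).\]
   Context: An edge-ordered graph is a finite simple graph together with a linear order on its edge set (usually given by an injective labeling $l:E\to\mathbb{N}$ or $l:E\to\mathbb{R}$). An edge-ordered graph $H$ contains $F$ (has a copy of $F$) if $F$ is isomorphic, by an isomorphism respecting the edge-order, to a subgraph of $H$ with the induced order; otherwise $H$ is $F$-free. For an edge-ordered graph $G$, $e_0+G+e_{\max}$ denotes the edge-ordered graph obtained from $G$ by adding two edges $e_0$ and $e_{\max}$, vertex-disjoint from $G$ and from each other, where $e_0$ has a label smaller than, and $e_{\max}$ a label larger than, all other labels. $sat_e(n,F)$ is the minimum number of edges in an $F$-free edge-ordered graph $H$ on $n$ vertices such that adding to $H$ any missing edge, inserted at an arbitrary position of the linear order of the edges, creates a copy of $F$ (i.e. for every missing edge and every position, a copy is created). Asymptotic notation is for $n\to\infty$ with $k$ and $G_k$ fixed. *)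

(* Defs.v *)
From mathcomp Require Import boolp classical_sets.
From mathcomp Require Import all_boot.
Set Implicit Arguments.
Unset Strict Implicit.
Unset Printing Implicit Defensive.

(* Edges are 2-element vertex sets; the values of [ele] outside [edges] carry
   no information. *)
Record eograph (T : finType) := EOGraph {
  edges : {set {set T}};
  ele : rel {set T};
  edges_card2 : forall e, e \in edges -> #|e| = 2;
  ele_antisym : {in edges &, antisymmetric ele};
  ele_trans : {in edges & &, transitive ele};
  ele_total : {in edges &, total ele}
}.

Definition is_complete (T : finType) (G : eograph T) : Prop :=
  forall e : {set T}, #|e| = 2 -> e \in edges G.

Definition contains (S T : finType) (F : eograph S) (H : eograph T) : Prop :=
  exists f : S -> T,
    [/\ injective f,
        forall e, e \in edges F -> f @: e \in edges H &
        {in edges F &, forall d e, ele F d e = ele H (f @: d) (f @: e)}].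

(* The linear order of [H'] is any one extending that of [H], that is, [e] is
   inserted at an arbitrary position. *)
Definition adds_edge (T : finType) (H : eograph T) (e : {set T})
    (H' : eograph T) : Prop :=
  [/\ e \notin edges H, edges H' = e |: edges H &
      {in edges H &, ele H' =2 ele H}].

Definition saturated (S T : finType) (F : eograph S) (H : eograph T) : Prop :=
  ~ contains F H /\ forall e H', adds_edge H e H' -> contains F H'.

Definition sat_size (S : finType) (n : nat) (F : eograph S) (m : nat) : Prop :=
  exists H : eograph 'I_n, saturated F H /\ #|edges H| = m.

(* The default value 0 is used only if no saturated graph exists, which
   [sat_eP] excludes as soon as [F] has an edge. *)
Definition sat_e (S : finType) (n : nat) (F : eograph S) : nat :=
  xget 0 [set m | sat_size n F m /\ forall m', sat_size n F m' -> m <= m']%classic.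

Definition edgeless (T : finType) : eograph T.
Proof.
by exists set0 (fun _ _ => true) => [e|e f|e f g|e f]; rewrite inE.
Defined.

Lemma sat_eP (S : finType) (n : nat) (F : eograph S) : edges F != set0 ->
  sat_size n F (sat_e n F) /\ forall m, sat_size n F m -> sat_e n F <= m.
Proof.
move=> /set0Pn[e0 e0F]; rewrite /sat_e.
set A := (X in xget 0 X).
suff : exists m, A m by move=> /(xgetPex 0).
have [m sm] : exists m, sat_size n F m.
  pose P m := `[< exists H : eograph 'I_n, ~ contains F H /\ #|edges H| = m >].
  have exP : exists m, P m.
    exists 0; apply/asboolP; exists (edgeless 'I_n); split; last by rewrite cards0.
    by move=> [f [_ /(_ _ e0F)]]; rewrite inE.
  have ubP m : P m -> m <= #|{set 'I_n}|.
    by move=> /asboolP[H [_ <-]]; exact: max_card.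
  have [m /asboolP[H [FH Hm]] mmax] := ex_maxnP exP ubP.
  exists m, H; split => //; split => // e H' [eH eH' _].
  apply: contrapT => FH'; have /mmax : P #|edges H'| by apply/asboolP; exists H'.
  by rewrite eH' cardsU1 eH Hm add1n ltnn.
have exS : exists m, `[< sat_size n F m >] by exists m; apply/asboolP.
have [m0 /asboolP sm0 minm0] := ex_minnP exS.
by exists m0; split => // m' /asboolP /minm0.
Qed.

Section AddExtremeEdges.
Variables (T : finType) (G : eograph T).

(* Two fresh pairs of vertices carry the edges e_0 and e_max. *)
Definition ext_vertex : finType := (T + (bool + bool))%type.

Definition edge0 : {set ext_vertex} :=
  [set inr (inl false); inr (inl true)].
Definition edgemax : {set ext_vertex} :=
  [set inr (inr false); inr (inr true)].

Definition lift_edge (e : {set T}) : {set ext_vertex} :=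
  [set inl x | x in e].

Definition ext_edges : {set {set ext_vertex}} :=
  edge0 |: (edgemax |: [set lift_edge e | e in edges G]).

Definition ext_le : rel {set ext_vertex} := fun d e =>
  [|| d == edge0, e == edgemax |
      [&& d != edgemax, e != edge0 & ele G (inl @^-1: d) (inl @^-1: e)]].

Lemma lift_edgeK e : inl @^-1: (lift_edge e) = e.
Proof.
apply/setP=> x; rewrite inE; apply/imsetP/idP => [[y ye [->]] //|xe].
by exists x.
Qed.

Lemma edge0_neq_max : (edge0 == edgemax) = false.
Proof. by apply/negP=> /eqP/setP/(_ (inr (inl false))); rewrite !inE. Qed.

Lemma lift_neq0 e : (lift_edge e == edge0) = false.
Proof.
apply/negP=> /eqP/setP/(_ (inr (inl false))); rewrite !inE eqxx.
by case/imsetP.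
Qed.

Lemma lift_neqmax e : (lift_edge e == edgemax) = false.
Proof.
apply/negP=> /eqP/setP/(_ (inr (inr false))); rewrite !inE eqxx.
by case/imsetP.
Qed.

Lemma ext_edgesP e : e \in ext_edges ->
  [\/ e = edge0, e = edgemax | exists2 d, d \in edges G & e = lift_edge d].
Proof.
rewrite !inE => /or3P[/eqP->|/eqP->|/imsetP[d dG ->]].
- exact: Or31.
- exact: Or32.
- by apply: Or33; exists d.
Qed.

Let simp := (eqxx, edge0_neq_max, eq_sym edgemax edge0, lift_neq0, lift_neqmax,
  lift_edgeK, orbT, andbF).

Definition add_extreme_edges : eograph ext_vertex.
Proof.
exists ext_edges ext_le.
- move=> e /ext_edgesP[->|->|[d dG ->]]; rewrite ?cards2 //.
  by rewrite card_imset ?(edges_card2 dG) // => x y [].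
- move=> d e /ext_edgesP[->|->|[d' dG ->]] /ext_edgesP[->|->|[e' eG ->]] //;
    rewrite /ext_le !simp //= => h.
  by rewrite (ele_antisym dG eG h).
- move=> d e f /ext_edgesP[->|->|[d' dG ->]] /ext_edgesP[->|->|[e' eG ->]]
    /ext_edgesP[->|->|[f' fG ->]]; rewrite /ext_le !simp //=.
  exact: (ele_trans dG eG fG).
- move=> d e /ext_edgesP[->|->|[d' dG ->]] /ext_edgesP[->|->|[e' eG ->]];
    rewrite /ext_le !simp //=.
  exact: (ele_total dG eG).
Defined.

End AddExtremeEdges.

(* Main.v *)
(* Let H be saturated and uv a non-edge.  Inserted at the bottom uv can play
   e_0, at the top e_max.  If no position gave uv a role inside G, then at some
   point a clique of edges above it would meet a copy of e_0 + G below it, and an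
   edge of that clique avoiding the copy would serve as e_max, contradicting that
   H is F-free; this is where k >= 5 enters.  So uv plays an edge ij of G.

   G is labelled so that for any i, j there are w1, w2 whose edges to i and to j
   are ordered oppositely.  Hence every non-edge uv of H is separated by some pair
   (w1, w2) of common neighbours.  Choose for every pair (w1, w2) a random order
   and keep the vertices whose edges all agree with it: these form a clique, and a
   vertex of degree d survives with probability at least 2^(-d^2).  With m edges
   and D = 4m/n, half of the vertices have degree at most D, so some clique has at
   least n / 2^(D^2 + 1) vertices, but also at most O(sqrt m) of them; this gives
   log n = O((D + 2)^2). *)
Require Import Defs.
From mathcomp Require Import all_boot zify.
Set Implicit Arguments.
Unset Strict Implicit.
Unset Printing Implicit Defensive.

(** * Edge orders as numerical labels, and the insertion of an edge *)

Section LabelledGraph.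
Variables (T : finType) (E : {set {set T}}) (L : {set T} -> nat).
Hypothesis E_card2 : forall e, e \in E -> #|e| = 2.
Hypothesis L_inj : {in E &, injective L}.

Definition labelled_graph : eograph T.
Proof.
exists E (fun d e => L d <= L e) => //.
- by move=> d e dE eE; rewrite -eqn_leq => /eqP; apply: L_inj.
- by move=> d e f _ _ _; apply: leq_trans.
- by move=> d e _ _; apply: leq_total.
Defined.

End LabelledGraph.

Section Rank.
Variables (T : finType) (H : eograph T).

(** Makes the abstract edge order numerical, so that a number can name the position of a new
    edge. *)
Definition rank (e : {set T}) := #|[set d in edges H | ele H d e]|.

Lemma ele_refl e : e \in edges H -> ele H e e.
Proof. by move=> eH; have := ele_total eH eH; rewrite orbb. Qed.

Lemma ele_rank d e : d \in edges H -> e \in edges H ->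
  ele H d e = (rank d <= rank e).
Proof.
move=> dH eH; apply/idP/idP => [de | ].
  apply: subset_leq_card; apply/subsetP => c; rewrite !inE => /andP[cH cd].
  by rewrite cH (ele_trans dH cH eH cd de).
apply: contraLR => nde; rewrite -ltnNge; apply: proper_card.
have ed : ele H e d by have := ele_total dH eH; rewrite (negbTE nde).
apply/properP; split.
  apply/subsetP => c; rewrite !inE => /andP[cH ce].
  by rewrite cH (ele_trans eH cH dH ce ed).
by exists d; rewrite !inE dH ?ele_refl.
Qed.

Lemma rank_inj : {in edges H &, injective rank}.
Proof.
move=> d e dH eH /eqP; rewrite eqn_leq -!ele_rank //; exact: ele_antisym.
Qed.

Lemma rank_le e : rank e <= #|edges H|.
Proof. by apply: subset_leq_card; apply/subsetP => d; rewrite inE => /andP[]. Qed.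

End Rank.

Section Insert.
Variables (T : finType) (H : eograph T) (p : {set T}).
Hypotheses (p2 : #|p| = 2) (pH : p \notin edges H).

(* The new edge goes just below the old edges of rank at least [x]; parity
   separates its label from theirs. *)
Definition insert_label x e := if e == p then x.*2 else (rank H e).*2.+1.

Lemma insert_card2 e : e \in p |: edges H -> #|e| = 2.
Proof. by rewrite !inE => /orP[/eqP-> | /edges_card2]. Qed.

Lemma insert_label_inj x : {in p |: edges H &, injective (insert_label x)}.
Proof.
move=> d e; rewrite !inE /insert_label.
case: eqP => [-> _|_ /= dH]; case: eqP => [-> _|_ /= eH] //; try lia.
by move=> /eq_add_S/double_inj; apply: rank_inj.
Qed.

Definition insert_edge x : eograph T :=
  labelled_graph insert_card2 (@insert_label_inj x).

Lemma insert_edgeE x : {in edges H &, ele (insert_edge x) =2 ele H}.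
Proof.
move=> d e dH eH; rewrite /= /insert_label.
rewrite !ifN ?ltnS ?leq_double ?ele_rank //.
- by apply: contraNneq pH => <-.
- by apply: contraNneq pH => <-.
Qed.

Lemma insert_adds x : adds_edge H p (insert_edge x).
Proof. by split => //; exact: insert_edgeE. Qed.

End Insert.

(** * The possible roles of an inserted edge *)

Section Contains.
Variables (S T : finType) (G : eograph S) (H : eograph T).

Lemma contains_extreme (h : S -> T) (q p : {set T}) : injective h ->
  (forall d, d \in edges G -> h @: d \in edges H) ->
  {in edges G &, forall d e, ele G d e = ele H (h @: d) (h @: e)} ->
  q \in edges H -> p \in edges H ->
  {in q, forall y i, y != h i} -> {in p, forall y i, y != h i} ->
  [disjoint q & p] ->
  rank H q < rank H p ->
  (forall d, d \in edges G -> rank H q < rank H (h @: d) < rank H p) ->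
  contains (add_extreme_edges G) H.
Proof.
move=> h_inj hE hle qH pH qh ph qp rqp rh.
have [q0 [q1 [q01 qE]]] : exists a b, a != b /\ q = [set a; b].
  by have /eqP/cards2P[a [b [ab ->]]] := edges_card2 qH; exists a, b.
have [p0 [p1 [p01 pE]]] : exists a b, a != b /\ p = [set a; b].
  by have /eqP/cards2P[a [b [ab ->]]] := edges_card2 pH; exists a, b.
pose f (z : ext_vertex S) := match z with
  | inl i => h i
  | inr (inl b) => if b then q1 else q0
  | inr (inr b) => if b then p1 else p0 end.
have f0 : f @: edge0 S = q by rewrite imsetU1 imset_set1 qE.
have f1 : f @: edgemax S = p by rewrite imsetU1 imset_set1 pE.
have fl d : f @: lift_edge d = h @: d by rewrite -imset_comp.
have fq b : f (inr (inl b)) \in q by rewrite qE !inE /=; case: b; rewrite eqxx ?orbT.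
have fp b : f (inr (inr b)) \in p by rewrite pE !inE /=; case: b; rewrite eqxx ?orbT.
have fqp b c : f (inr (inl b)) != f (inr (inr c)).
  apply: contraTneq qp => bc; apply/pred0Pn; exists (f (inr (inl b))).
  by apply/andP; split; [exact: fq | rewrite bc; exact: fp].
exists f; split.
- have fqi b i : f (inr (inl b)) != h i by exact: qh.
  have fpi b i : f (inr (inr b)) != h i by exact: ph.
  move=> [i|[b|b]] [j|[c|c]] //= E.
  + by rewrite (h_inj _ _ E).
  + by have := fqi c i; rewrite /= E eqxx.
  + by have := fpi c i; rewrite /= E eqxx.
  + by have := fqi b j; rewrite /= E eqxx.
  + by move: q01; case: b c E => -[] // ->; rewrite eqxx.
  + by have := fqp b c; rewrite /= E eqxx.
  + by have := fpi b j; rewrite /= E eqxx.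
  + by have := fqp c b; rewrite /= E eqxx.
  + by move: p01; case: b c E => -[] // ->; rewrite eqxx.
- by move=> e /ext_edgesP[->|->|[d dG ->]]; rewrite ?f0 ?f1 ?fl ?hE.
- have simp := (f0, f1, fl, eqxx, edge0_neq_max, eq_sym (edgemax S) (edge0 S),
    lift_neq0, lift_neqmax, lift_edgeK, orbT, andbF).
  move=> d e /ext_edgesP[->|->|[d' dG ->]] /ext_edgesP[->|->|[e' eG ->]] /=;
    rewrite /ext_le !simp /= ?hle // ele_rank ?hE ?leqnn //; apply/esym.
  + exact: ltnW.
  + by have := rh _ eG; lia.
  + by lia.
  + by have := rh _ eG; lia.
  + by have := rh _ dG; lia.
  + by have := rh _ dG; lia.
Qed.

End Contains.

Lemma imset_pair (aT rT : finType) (f : aT -> rT) x y :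
  f @: [set x; y] = [set f x; f y].
Proof. by rewrite imsetU1 imset_set1. Qed.

Section Middle.
Variables (S T : finType) (G : eograph S) (H : eograph T).
Hypotheses (G_complete : is_complete G) (S_ge5 : 5 <= #|S|).
Hypothesis H_free : ~ contains (add_extreme_edges G) H.

(** The trace left in [H] by a copy in which the edge inserted at [x] plays $e_0$. *)
Definition high_clique x := exists A : {set T}, 5 <= #|A| /\
  {in A &, forall y z, y != z ->
    [set y; z] \in edges H /\ x <= rank H [set y; z]}.

(** The trace left by a copy in which the edge inserted at [x] plays $e_{max}$; [q] is the image of
    $e_0$. *)
Definition low_copy x := exists (h : S -> T) (q : {set T}),
  [/\ injective h, q \in edges H, {in q, forall y i, y != h i},
      {in edges G &, forall d e, ele G d e = ele H (h @: d) (h @: e)} &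
      forall d, d \in edges G -> h @: d \in edges H /\
        rank H q < rank H (h @: d) < x].

(* The clique [A] and the copy [B] of [G] share no triangle, and [q] is not
   inside [A]; so [A] has an edge [p] disjoint from [B] and [q]. *)
Lemma high_low_disjoint x : high_clique x -> low_copy x.+1 -> False.
Proof.
move=> [A [A5 AE]] [h [q [h_inj qH qh hle hE]]]; apply: H_free.
pose B := h @: [set: S].
have BE y z : y \in B -> z \in B -> y != z ->
    [/\ [set y; z] \in edges H, rank H q < rank H [set y; z] &
        rank H [set y; z] <= x].
  move=> /imsetP[i _ ->] /imsetP[j _ ->] hij.
  have ij : i != j by apply: contraNneq hij => ->.
  have : [set i; j] \in edges G by apply: G_complete; rewrite cards2 ij.
  by rewrite -imset_pair => /hE[? /andP[]].
(* An edge inside both sets has rank at least [x] and at most [x]. Ranks are injective, so two edges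
   of a common triangle would coincide. *)
have AB : #|A :&: B| <= 2.
  rewrite leqNgt; apply/negP => /card_gt2P[a [b [c [[]]]]].
  rewrite !inE => /andP[aA aB] /andP[bA bB] /andP[cA cB] [ab bc ca].
  have rk y z : y \in A -> z \in A -> y \in B -> z \in B -> y != z ->
      [set y; z] \in edges H /\ rank H [set y; z] = x.
    move=> yA zA yB zB yz; have [? r1] := AE _ _ yA zA yz.
    by have [_ _ r2] := BE _ _ yB zB yz; split=> //; apply/eqP; rewrite eqn_leq r1 r2.
  have [E1 r1] := rk _ _ aA bA aB bB ab.
  have [E2 r2] := rk _ _ bA cA bB cB bc.
  have /setP/(_ a) : [set a; b] = [set b; c] by apply: (@rank_inj _ H); rewrite // r1.
  by rewrite !inE eqxx (negbTE ab) eq_sym (negbTE ca).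
have /card_gt1P[i [j [_ _ ij]]] : 1 < #|S| by lia.
have ijG : [set i; j] \in edges G by apply: G_complete; rewrite cards2 ij.
(* Edges inside [A] have rank at least [x], whereas [q] lies strictly below an edge of the copy and
   so below [x]. *)
have Aq : #|A :&: q| <= 1.
  rewrite leqNgt; apply/negP => /card_gt1P[a [b []]].
  rewrite !inE => /andP[aA aq] /andP[bA bq] ab.
  have abq : [set a; b] = q.
    apply/eqP; rewrite eqEcard cards2 ab (edges_card2 qH) andbT.
    by apply/subsetP => y; rewrite !inE => /orP[]/eqP->.
  have [_] := AE _ _ aA bA ab; rewrite abq.
  by have [_ /andP[]] := hE _ ijG; lia.
(* Of at least 5 vertices, at most 2 are lost to [B] and 1 to [q], which leaves the two ends of an
   edge. *)
have : 1 < #|A :\: (B :|: q)|.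
  have := cardsID (B :|: q) A; rewrite setIUr.
  have := cardsU (A :&: B) (A :&: q); lia.
case/card_gt1P=> a [b []]; rewrite !inE !negb_or.
move=> /andP[/andP[aB aq] aA] /andP[/andP[bB bq] bA] ab.
have [pH xp] := AE _ _ aA bA ab.
have hp d : d \in edges G -> rank H (h @: d) < rank H [set a; b].
  move=> dG; have [hdH /andP[_ hdx]] := hE d dG.
  rewrite ltn_neqAle (leq_trans _ xp) // andbT.
  apply: contraNneq aB => /(rank_inj hdH pH) E.
  have : a \in h @: d by rewrite E !inE eqxx.
  by case/imsetP=> y _ ->; rewrite imset_f.
apply: (@contains_extreme _ _ _ _ h q [set a; b]) => //.
- by move=> d /hE[].
- move=> y; rewrite !inE => /orP[]/eqP-> i'; apply: contraNneq aB => E.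
    by rewrite E imset_f.
  by case/negP: bB; rewrite E imset_f.
- rewrite disjoint_sym disjoints_subset; apply/subsetP => y; rewrite !inE.
  by case/orP=> /eqP->.
- by have [_ /andP[qi _]] := hE _ ijG; exact: ltn_trans qi (hp _ ijG).
- by move=> d dG; rewrite hp // andbT; have [_ /andP[]] := hE d dG.
Qed.

(** Here [p] plays the edge [c] of [G]. Only the other edges are compared, which makes the notion
    independent of where [p] is inserted. *)
Definition middle_copy (p : {set T}) := exists (h : S -> T) (c : {set S}),
  [/\ injective h, c \in edges G, h @: c = p,
      forall d, d \in edges G -> d != c -> h @: d \in edges H &
      {in edges G &, forall d e, d != c -> e != c ->
        ele G d e = ele H (h @: d) (h @: e)}].

Lemma inserted_edge_role (p : {set T}) (p2 : #|p| = 2) (pH : p \notin edges H) x :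
  contains (add_extreme_edges G) (insert_edge p2 pH x) ->
  [\/ high_clique x, low_copy x | middle_copy p].
Proof.
move=> [f [f_inj fE fle]]; pose h i := f (inl i).
have h_inj : injective h by move=> i j /f_inj [].
have fl d : f @: lift_edge d = h @: d by rewrite -imset_comp.
have F0 : edge0 S \in ext_edges G by rewrite !inE eqxx.
have F1 : edgemax S \in ext_edges G by rewrite !inE eqxx orbT.
have Fl d : d \in edges G -> lift_edge d \in ext_edges G.
  by move=> dG; rewrite !inE imset_f ?orbT.
(* A copy that does not use [p] would already lie in [H]. *)
have [c cF cp] : exists2 c, c \in ext_edges G & f @: c = p.
  have [/exists_inP[c ? /eqP ?]|] := boolP [exists c in ext_edges G, f @: c == p].
    by exists c.
  rewrite negb_exists_in => /forall_inP np; case: H_free.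
  have fH e : e \in ext_edges G -> f @: e \in edges H.
    by move=> eF; have := fE e eF; rewrite !inE (negbTE (np e eF)).
  by exists f; split=> // d e dF eF; rewrite fle // insert_edgeE ?fH.
have fp e : e != c -> (f @: e == p) = false.
  by move=> ec; rewrite -cp; apply: contraNF ec => /eqP/(imset_inj f_inj)->.
have fH e : e \in ext_edges G -> e != c -> f @: e \in edges H.
  by move=> eF ec; have := fE e eF; rewrite !inE fp.
have hH d : d \in edges G -> lift_edge d != c -> h @: d \in edges H.
  by move=> dG; rewrite -fl; apply: fH; exact: Fl.
have simp := (eqxx, edge0_neq_max, eq_sym (edgemax S) (edge0 S),
    lift_neq0, lift_neqmax, lift_edgeK, orbT, andbF).
have hle d e : d \in edges G -> e \in edges G ->
    lift_edge d != c -> lift_edge e != c ->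
    ele G d e = ele H (h @: d) (h @: e).
  move=> dG eG dc ec; have := fle _ _ (Fl _ dG) (Fl _ eG).
  by rewrite insert_edgeE ?fH ?Fl // !fl => <-; rewrite /= /ext_le !simp.
have /ext_edgesP[c0|c1|[c' c'G cE]] := cF.
- apply: Or31; exists (h @: [set: S]); split; first by rewrite card_imset ?cardsT.
  move=> _ _ /imsetP[i _ ->] /imsetP[j _ ->] hij.
  have ijG : [set i; j] \in edges G.
    apply: G_complete; rewrite cards2.
    by have -> : i != j by apply: contraNneq hij => ->.
  have lc : lift_edge [set i; j] != c by rewrite c0 lift_neq0.
  rewrite -imset_pair; split; first exact: hH.
  have := fle _ _ F0 (Fl _ ijG); rewrite /= /ext_le !simp /= /insert_label.
  by rewrite -{1}c0 cp eqxx fp // fl => /esym; lia.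
- have c0 : edge0 S != c by rewrite c1 edge0_neq_max.
  have f1 : f @: edgemax S = p by rewrite -c1.
  have lc d : lift_edge d != c by rewrite c1 lift_neqmax.
  apply: Or32; exists h, (f @: edge0 S); split => //.
  + exact: fH.
  + move=> _ /imsetP[z z0 ->] i; apply: contraTneq z0 => /f_inj ->.
    by rewrite !inE.
  + by move=> d e dG eG; apply: hle.
  + move=> d dG; split; first exact: hH.
    have := fle _ _ (Fl _ dG) F1; have := fle _ _ (Fl _ dG) F0.
    rewrite /= /ext_le !simp /= /insert_label f1 eqxx !fp // fl.
    by move=> /esym; lia.
- have lc d : d != c' -> lift_edge d != c.
    by rewrite cE; apply: contraNneq => dc; rewrite -(lift_edgeK d) dc lift_edgeK.
  apply: Or33; exists h, c'; split => //.
  + by rewrite -fl -cE.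
  + by move=> d dG dc; apply: hH; rewrite ?lc.
  + by move=> d e dG eG dc ec; apply: hle; rewrite ?lc.
Qed.

Lemma nonedge_middle (p : {set T}) : #|p| = 2 -> p \notin edges H ->
  (forall e H', adds_edge H e H' -> contains (add_extreme_edges G) H') ->
  middle_copy p.
Proof.
move=> p2 pH sat; apply: boolp.contrapT => nmid.
have role x : high_clique x \/ low_copy x.
  have := inserted_edge_role (sat _ _ (insert_adds p2 pH x)).
  by case=> [hx|lx|//]; [left | right].
have /card_gt1P[i [j [_ _ ij]]] : 1 < #|S| by lia.
have ijG : [set i; j] \in edges G by apply: G_complete; rewrite cards2 ij.
(* [low_copy 0] would need a rank below 0, and [high_clique x] rules out [low_copy x.+1]. Induction
   thus gives high cliques even above the largest rank. *)
have high x : high_clique x.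
  elim: x => [|x hx]; last by case: (role x.+1) => // /(high_low_disjoint hx).
  by case: (role 0) => // -[h [q [_ _ _ _ /(_ _ ijG)[_]]]]; rewrite andbF.
have [A [A5 AE]] := high #|edges H|.+1.
have /card_gt1P[a [b [aA bA ab]]] : 1 < #|A| by lia.
by have [_] := AE a b aA bA ab; rewrite ltnNge rank_le.
Qed.

End Middle.

(** * Non-edges separated by pairs of common neighbours *)

Definition crossing (T : finType) (H : eograph T) (u v : T) := exists w1 w2,
  [/\ [set u; w1] \in edges H, [set u; w2] \in edges H,
      [set v; w1] \in edges H, [set v; w2] \in edges H &
      ele H [set u; w1] [set u; w2] != ele H [set v; w1] [set v; w2]].

(** The four edges of a crossing of [i] and [j] differ from the edge [ij], so their images are old
    edges of [H], ordered as in [G]. *)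
Lemma middle_crossing (S T : finType) (G : eograph S) (H : eograph T) u v :
  (forall i j, i != j -> crossing G i j) ->
  u != v -> middle_copy G H [set u; v] -> crossing H u v.
Proof.
move=> Gx uv [h [c [h_inj cG hc hE hle]]].
have /imsetP[i ic uE] : u \in h @: c by rewrite hc !inE eqxx.
have /imsetP[j jc vE] : v \in h @: c by rewrite hc !inE eqxx orbT.
have ij : i != j by apply: contraNneq uv => ij; rewrite uE vE ij.
have cE : c = [set i; j].
  apply/esym/eqP; rewrite eqEcard cards2 ij (edges_card2 cG) andbT.
  by apply/subsetP => y; rewrite !inE => /orP[]/eqP->.
have [w1 [w2 [iw1 iw2 jw1 jw2 w12]]] := Gx i j ij.
have nc w : [set i; w] \in edges G -> [set j; w] \in edges G ->
    [set i; w] != c /\ [set j; w] != c.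
  move=> /edges_card2 iw /edges_card2 jw; rewrite cE.
  have wi : w != i by apply: contra_eqN iw => /eqP->; rewrite setUid cards1.
  have wj : w != j by apply: contra_eqN jw => /eqP->; rewrite setUid cards1.
  by split; apply/eqP => /setP/(_ w); rewrite !inE eqxx (negbTE wi) (negbTE wj) orbT.
have [ni1 nj1] := nc _ iw1 jw1; have [ni2 nj2] := nc _ iw2 jw2.
by exists (h w1), (h w2); rewrite uE vE -!imset_pair !hE // -!hle.
Qed.

(** * A labelling of the complete graph in which every pair is crossed *)

(* For [i < j].  On K_4 the perfect matchings are ordered
   {02, 13} < {03, 12} < {01, 23}, which makes the edges from two vertices to the
   other two ordered oppositely.  A vertex [j >= 4] is joined on top of everything
   before it, in the order j - 1, 0, 1, ..., j - 2.  For [j > 4] it sees j - 1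
   before 0, whereas i < j - 1 sees j - 1 last; and it sees 0 before j - 2, whereas
   j - 1 sees j - 2 first. *)
Definition twisted_label i j :=
  if j < 4 then nth 0 [:: 5; 0; 3; 2; 1; 4] (i + 'C(j, 2))
  else j * j + (if i.+1 == j then 0 else i.+1).

Definition sym_label i j := twisted_label (minn i j) (maxn i j).

Lemma sym_labelC i j : sym_label i j = sym_label j i.
Proof. by rewrite /sym_label minnC maxnC. Qed.

(** The table values are below 6, and each [j >= 4] has its labels in its own block from [j * j] to
    [j.+1 * j.+1]. *)
Lemma twisted_label_inj i j i' j' : i < j -> i' < j' ->
  twisted_label i j = twisted_label i' j' -> i = i' /\ j = j'.
Proof.
have small a b : a < b -> b < 4 -> twisted_label a b < 6.
  by case: b => [|[|[|[|b]]]] //; case: a => [|[|[|a]]].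
have big a b : a < b -> 4 <= b ->
    [/\ b * b <= twisted_label a b, twisted_label a b < b.+1 * b.+1 &
    twisted_label a b = b * b + (if a.+1 == b then 0 else a.+1)].
  by move=> ab b4; rewrite /twisted_label ltnNge b4 /=; split=> //; case: eqP; nia.
move=> ij ij'; case: (ltnP j 4) => j4; case: (ltnP j' 4) => j4'.
- by move: j j' ij ij' j4 j4' => [|[|[|[|j]]]] [|[|[|[|j']]]] //;
    case: i => [|[|[|i]]] //; case: i' => [|[|[|i']]].
- by have := small _ _ ij j4; have [] := big _ _ ij' j4'; nia.
- by have := small _ _ ij' j4'; have [] := big _ _ ij j4; nia.
- have [l1 u1 e1] := big _ _ ij j4; have [l2 u2 e2] := big _ _ ij' j4' => E.
  have jj : j = j' by nia.
  by move: E; rewrite e1 e2 jj; do 2 case: eqP; lia.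
Qed.

Lemma sym_label_crossing k i j : 5 <= k -> i < j -> j < k -> exists w1 w2,
  [/\ w1 < k, w2 < k, [&& w1 != i, w1 != j, w2 != i & w2 != j],
      sym_label i w1 < sym_label i w2 & sym_label j w2 < sym_label j w1].
Proof.
move=> k5 ij jk; have [j5|j5] := ltnP j 5.
  (* A finite check inside the first five vertices, available since [5 <= k]. *)
  have : has (fun w1 => has (fun w2 => [&& [&& w1 != i, w1 != j, w2 != i & w2 != j],
      sym_label i w1 < sym_label i w2 & sym_label j w2 < sym_label j w1])
     (iota 0 5)) (iota 0 5).
    by move: j ij j5 {jk} => [|[|[|[|[|j]]]]] //; case: i => [|[|[|[|i]]]].
  move=> /hasP[w1]; rewrite mem_iota => /andP[_ w15] /hasP[w2].
  rewrite mem_iota => /andP[_ w25] /and3P[? ? ?].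
  by exists w1, w2; split=> //; lia.
have lab a b : a < b -> 4 <= b ->
    sym_label a b = b * b + (if a.+1 == b then 0 else a.+1).
  move=> ab b4; rewrite /sym_label (minn_idPl (ltnW ab)) (maxn_idPr (ltnW ab)).
  by rewrite /twisted_label ltnNge b4.
have bound a b m : a < b -> b < m -> 4 <= m -> sym_label a b < m * m.
  move=> ab bm m4; have [b4|b4] := ltnP b 4.
    have : sym_label a b < 6.
      by move: b ab b4 {bm} => [|[|[|[|b]]]] //; case: a => [|[|[|[|a]]]].
    by nia.
  by rewrite lab //; case: eqP => _; nia.
(* When [i] is [j - 1], it sees [i - 1] before 0, while [j] sees 0 before [i - 1]. *)
have [iE|ij1] := eqVneq i.+1 j.
  exists i.-1, 0; rewrite (sym_labelC i i.-1) (sym_labelC i 0).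
  rewrite (sym_labelC j i.-1) (sym_labelC j 0).
  rewrite !lab; try lia.
  by split; do ?case: eqP; lia.
(* The vertex 0 is played against [j - 1], with 1 in its place when [i] is 0. *)
pose w := (i == 0 : nat).
have [wi w1] : w != i /\ w <= 1 by rewrite /w; case: eqP; lia.
exists w, j.-1; split; try lia.
- rewrite (lab i j.-1); try lia.
  suff : sym_label i w < j.-1 * j.-1 by lia.
  case: (ltnP i w) => iw; first by apply: bound; lia.
  by rewrite sym_labelC; apply: bound; lia.
- rewrite (sym_labelC j j.-1) (sym_labelC j w) !lab; try lia.
  by do 2 case: eqP; lia.
Qed.

Lemma sym_label_inj i j i' j' : i != j -> i' != j' ->
  sym_label i j = sym_label i' j' ->
  (i = i' /\ j = j') \/ (i = j' /\ j = i').
Proof.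
move=> ij ij' /twisted_label_inj[]; lia.
Qed.

Section TwistedGraph.
Variable k : nat.
Hypothesis k5 : 5 <= k.

(** Both orders of the two ends give the same value, so the maxima just read [sym_label] off an
    unordered pair. *)
Definition edge_label (e : {set 'I_k}) :=
  \max_(i in e) \max_(j in e :\ i) sym_label i j.

Lemma edge_labelE (i j : 'I_k) : i != j -> edge_label [set i; j] = sym_label i j.
Proof.
move=> ij; rewrite /edge_label big_setU1 ?inE //= big_set1.
have -> : [set i; j] :\ i = [set j].
  by apply/setP => y; rewrite !inE; have [->|] := eqVneq y i; rewrite ?(negbTE ij).
have -> : [set i; j] :\ j = [set i].
  apply/setP => y; rewrite !inE; have [->|] := eqVneq y j; last by rewrite orbF.
  by rewrite eq_sym (negbTE ij).
by rewrite !big_set1 (sym_labelC j) maxnn.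
Qed.

Lemma complete_card2 e : e \in [set e : {set 'I_k} | #|e| == 2] -> #|e| = 2.
Proof. by rewrite inE => /eqP. Qed.

Lemma edge_label_inj :
  {in [set e : {set 'I_k} | #|e| == 2] &, injective edge_label}.
Proof.
move=> d e; rewrite !inE => /cards2P[i [j [ij ->]]] /cards2P[i' [j' [ij' ->]]].
rewrite !edge_labelE // => /sym_label_inj[//|//|[]|[]].
  by move=> /val_inj-> /val_inj->.
by move=> /val_inj-> /val_inj->; rewrite setUC.
Qed.

Definition twisted_graph : eograph 'I_k :=
  labelled_graph complete_card2 edge_label_inj.

Lemma twisted_graph_complete : is_complete twisted_graph.
Proof. by move=> e e2; rewrite inE e2. Qed.

Lemma twisted_graph_crossing (i j : 'I_k) : i != j -> crossing twisted_graph i j.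
Proof.
wlog ij : i j / i < j => [wl ij|_].
  have [/wl/(_ ij)//|ji|/val_inj E] := ltngtP i j; last by rewrite E eqxx in ij.
  have [|w1 [w2 [? ? ? ? x]]] := wl _ _ ji; first by rewrite eq_sym.
  by exists w1, w2; split=> //; rewrite eq_sym.
have [w1 [w2 [k1 k2 /and4P[i1 j1 i2 j2] l1 l2]]] := sym_label_crossing k5 ij (ltn_ord j).
exists (Ordinal k1), (Ordinal k2).
have E (a b : 'I_k) : b != a -> [set a; b] \in edges twisted_graph.
  by move=> ab; rewrite inE cards2 (eq_sym a) ab.
split; rewrite ?E //= !edge_labelE 1?eq_sym //=.
by rewrite (ltnW l1) leqNgt l2.
Qed.

End TwistedGraph.

(** * Averaging over random bits *)

Lemma card_compatible (X : finType) (D : {set X}) (g : X -> bool) :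
  2 ^ #|D| * #|[set s : {ffun X -> bool} | [forall x in D, s x == g x]]| = 2 ^ #|X|.
Proof.
have -> : #|[set s : {ffun X -> bool} | [forall x in D, s x == g x]]| =
    #|family (fun x => if x \in D then pred1 (g x) else predT)|.
  apply: eq_card => s; rewrite inE; apply/forall_inP/familyP => [sg x|sg x xD].
    by case: ifP => // /sg.
  by have := sg x; rewrite xD.
rewrite card_family foldrE big_map big_enum (bigID (mem D)) /=.
rewrite big1 => [|x xD]; last by rewrite xD card1.
rewrite (eq_bigr (fun=> 2)) => [|x xD]; last by rewrite (negbTE xD) card_bool.
by rewrite prod_nat_const mul1n -expnD -(cardC (mem D)).
Qed.

(* Averaging over a uniformly random [s]: each [u] is compatible with [s] with
   probability [2 ^- #|D u|]. *)
Lemma exists_compatible (U X : finType) (A : {set U}) (D : U -> {set X})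
    (g : U -> X -> bool) t :
  {in A, forall u, #|D u| <= t} ->
  exists s : {ffun X -> bool},
    #|A| <= 2 ^ t * #|[set u in A | [forall x in D u, s x == g u x]]|.
Proof.
move=> Dt; pose C (s : {ffun X -> bool}) u := [forall x in D u, s x == g u x].
suff [s sP] : exists s, #|A| <= 2 ^ t * #|[set u in A | C s u]| by exists s.
apply/existsP; apply: contraT; rewrite negb_exists => /forallP small.
have total : \sum_(s : {ffun X -> bool}) #|[set u in A | C s u]| =
    \sum_(u in A) #|[set s | C s u]|.
  rewrite (eq_bigr (fun s => \sum_(u in A) C s u)) => [|s _].
    rewrite exchange_big; apply: eq_bigr => u _.
    by rewrite -sum1_card [RHS]big_mkcond; apply: eq_bigr => s _; rewrite inE; case: (C s u).
  rewrite -sum1_card big_mkcond [RHS]big_mkcond; apply: eq_bigr => u _.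
  by rewrite inE; case: (u \in A); case: (C s u).
have lo : #|A| * 2 ^ #|X| <= 2 ^ t * \sum_(s : {ffun X -> bool}) #|[set u in A | C s u]|.
  rewrite total big_distrr /= -sum_nat_const; apply: leq_sum => u uA.
  by rewrite -(card_compatible (D u) (g u)) leq_mul2r leq_pexp2l ?Dt ?orbT.
(* Each [s] is assumed to miss the bound by at least 1; summed over all [s], this contradicts
   [lo]. *)
have hi : 2 ^ t * \sum_(s : {ffun X -> bool}) #|[set u in A | C s u]| +
    #|{ffun X -> bool}| <= #|A| * 2 ^ #|X|.
  have -> : 2 ^ #|X| = #|{ffun X -> bool}| by rewrite card_ffun card_bool.
  have : \sum_(s : {ffun X -> bool}) (2 ^ t * #|[set u in A | C s u]| + 1) <=
      \sum_(s : {ffun X -> bool}) #|A| by apply: leq_sum => s _; rewrite addn1 ltnNge.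
  by rewrite big_split /= !sum_nat_const -big_distrr muln1 [leqRHS]mulnC.
have ffun_gt0 : 0 < #|{ffun X -> bool}| by rewrite card_ffun card_bool expn_gt0.
by move: (leq_trans hi lo); rewrite -[leqRHS]addn0 leq_add2l leqNgt ffun_gt0.
Qed.

(** * Degrees, cliques and the bound on the number of edges *)

Section Degree.
Variables (T : finType) (H : eograph T).

Definition nbhd u := [set w | [set u; w] \in edges H].

Lemma sum_degree : \sum_u #|nbhd u| <= 2 * #|edges H|.
Proof.
have deg u : #|nbhd u| <= #|[set e in edges H | u \in e]|.
  rewrite -(card_in_imset (f := fun w => [set u; w])) => [|w w'].
    apply: subset_leq_card; apply/subsetP => _ /imsetP[w + ->].
    by rewrite !inE eqxx => ->.
  rewrite !inE => /edges_card2 uw _ E.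
  have wu : u != w by move: uw; rewrite cards2; case: eqP.
  have /setP/(_ w) := E; rewrite !inE eqxx orbT eq_sym (negbTE wu) /=.
  by move=> /esym/eqP.
apply: (@leq_trans (\sum_u #|[set e in edges H | u \in e]|)).
  by apply: leq_sum => u _; apply: deg.
rewrite (eq_bigr (fun u => \sum_(e in edges H) (u \in e))) => [|u _]; last first.
  rewrite -sum1_card big_mkcond [RHS]big_mkcond; apply: eq_bigr => e _.
  by rewrite inE; case: (e \in edges H); case: (u \in e).
rewrite exchange_big /= mulnC -sum_nat_const; apply: leq_sum => e eH.
by rewrite -(edges_card2 eH) -sum1_card [leqRHS]big_mkcond leq_sum // => u; case: ifP.
Qed.

Lemma clique_size (A : {set T}) :
  {in A &, forall u v, u != v -> [set u; v] \in edges H} ->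
  #|A| * #|A|.-1 <= 2 * #|edges H|.
Proof.
move=> Acl; apply: leq_trans sum_degree.
rewrite (bigID (mem A)) /= -sum_nat_const.
apply: leq_trans (leq_addr _ _); apply: leq_sum => u uA.
rewrite (cardsD1 u A) uA; apply: subset_leq_card; apply/subsetP => v.
by rewrite !inE => /andP[vu vA]; apply: Acl; rewrite // eq_sym.
Qed.

(** Markov's inequality for the degree sum. *)
Lemma low_degree D : #|T| * D.+1 >= 4 * #|edges H| ->
  #|T| <= 2 * #|[set u | #|nbhd u| <= D]|.
Proof.
move=> TD; rewrite -cardsT.
pose A := [set u | #|nbhd u| <= D].
have : #|~: A| * D.+1 <= 2 * #|edges H|.
  apply: leq_trans sum_degree; rewrite [leqRHS](bigID (mem (~: A))) /=.
  apply: leq_trans (leq_addr _ _); rewrite -sum_nat_const; apply: leq_sum => u.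
  by rewrite !inE ltnNge.
have := cardsC A; rewrite cardsT -/A; nia.
Qed.

Hypothesis H_crossing : forall u v, u != v -> [set u; v] \notin edges H ->
  crossing H u v.

Lemma crossing_clique (A : {set T}) D : {in A, forall u, #|nbhd u| <= D} ->
  exists S : {set T}, {in S &, forall u v, u != v -> [set u; v] \in edges H} /\
    #|A| <= 2 ^ (D * D) * #|S|.
Proof.
move=> AD.
(* [s] has one bit per ordered pair (w1, w2), and [u] constrains at most [D * D] of them. *)
have [|s sA] := @exists_compatible _ _ A (fun u => setX (nbhd u) (nbhd u))
  (fun u w => ele H [set u; w.1] [set u; w.2]) (D * D).
  by move=> u uA; rewrite cardsX leq_mul ?AD.
eexists; split; last exact: sA.
move=> u v; rewrite !inE => /andP[_ /forall_inP su] /andP[_ /forall_inP sv] uv.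
apply: contraT => /(H_crossing uv)[w1 [w2 [u1 u2 v1 v2]]].
have := su (w1, w2); rewrite !inE u1 u2 => /(_ isT)/eqP <-.
have := sv (w1, w2); rewrite !inE v1 v2 => /(_ isT)/eqP <-.
by rewrite eqxx.
Qed.

Lemma crossing_size : #|T| <= 4 ^ ((4 * #|edges H|) %/ #|T|).+2 ^ 2.
Proof.
set m := #|edges H|; set n := #|T|; set D := (4 * m) %/ n.
have [n0|n0] := posnP n; first by rewrite [leqLHS]n0.
have mD : 4 * m < n * D.+1 by rewrite [ltnRHS]mulnC -ltn_divLR.
have nA := low_degree (ltnW mD).
have [|S [Scl AS]] := @crossing_clique [set u | #|nbhd u| <= D] D.
  by move=> u; rewrite inE.
have := clique_size Scl; rewrite -/m => Sm.
set a := 2 ^ (D * D) in AS *.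
have nS : n <= 2 * a * #|S| by rewrite -mulnA (leq_trans nA) // leq_mul2l AS orbT.
(* With s the size of [S], this is s(s - 1) <= 2m combined with (s - 1)^2 + 1 >= 0. *)
have S2 : #|S| * #|S| <= 4 * m + 2 by nia.
(* The square of [nS], with 4m + 2 <= n(D + 2); one factor [n] then cancels. *)
have nn : n * n <= 4 * (a * a) * (D.+2 * n).
  apply: (@leq_trans (2 * a * #|S| * (2 * a * #|S|))); first exact: leq_mul.
  have -> : 2 * a * #|S| * (2 * a * #|S|) = 4 * (a * a) * (#|S| * #|S|) by lia.
  rewrite leq_mul2l; apply/orP; right; nia.
have n1 : n <= 4 * (a * a) * D.+2 by rewrite mulnA leq_pmul2r in nn.
have a2 : a * a = 4 ^ (D * D) by rewrite /a -expnD addnn -mul2n expnM.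
apply: leq_trans n1 _; rewrite a2.
(* The exponents add up to D^2 + D + 3, which is at most (D + 2)^2. *)
apply: (@leq_trans (4 * 4 ^ (D * D) * 4 ^ D.+2)).
  by rewrite leq_mul2l ltnW ?orbT // ltn_expl.
by rewrite -expnS -expnD leq_exp2l //; nia.
Qed.

End Degree.

(** * The bound for [sat_e] and its asymptotic form *)

Lemma saturated_size (S : finType) n (G : eograph S) :
  5 <= #|S| -> is_complete G -> (forall i j, i != j -> crossing G i j) ->
  n <= 4 ^ ((4 * sat_e n (add_extreme_edges G)) %/ n).+2 ^ 2.
Proof.
move=> S5 Gc Gx.
(* Guarantees that [sat_e] is attained by a saturated graph and is not the default value. *)
have F0 : edges (add_extreme_edges G) != set0.
  by apply/set0Pn; exists (edge0 S); rewrite !inE eqxx.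
have [[H [[Hfree Hsat] <-]] _] := sat_eP n F0.
have := @crossing_size _ H; rewrite card_ord; apply => u v uv uvH.
apply: (@middle_crossing _ _ G) => //.
by apply: nonedge_middle; rewrite ?cards2 ?uv.
Qed.

From mathcomp Require Import all_boot all_order all_algebra.
From mathcomp Require Import all_classical all_reals all_analysis.
From mathcomp Require Import lra.
Import Order.TTheory GRing.Theory Num.Theory.
Import numFieldNormedType.Exports.
Local Open Scope classical_set_scope.
Local Open Scope ring_scope.
Unset Implicit Arguments.

(** Take logarithms: the crude bound [ln 4 <= 4] makes the right side the square of 2(D + 2), and nD
    <= 4m. *)
Lemma sqrt_ln_le (R : realType) n m : (0 < n)%N -> (n <= 4 ^ (4 * m %/ n).+2 ^ 2)%N ->
  n%:R * Num.sqrt (ln (n%:R : R)) <= 8 * m%:R + 4 * n%:R.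
Proof.
move=> n0 nm; set D := (4 * m %/ n)%N in nm.
have n0R : (0 < n%:R :> R) by rewrite ltr0n.
have ln4 : ln (4 : R) <= 4 by apply/ltW/ln_sublinear; rewrite ltr0n.
have lnn : ln (n%:R : R) <= (2 * D.+2%:R) ^+ 2.
  have : (n%:R : R) <= 4 ^+ (D.+2 ^ 2) by rewrite -natrX ler_nat.
  rewrite -ler_ln ?posrE ?exprn_gt0 //.
  move=> /le_trans; apply; rewrite lnXn //.
  rewrite -[leLHS]mulr_natr natrX exprMn ler_wpM2r ?sqr_ge0 //; lra.
have s : Num.sqrt (ln (n%:R : R)) <= 2 * D.+2%:R.
  by have := ler_wsqrtr lnn; rewrite sqrtr_sqr ger0_norm.
apply: le_trans (ler_wpM2l (ltW n0R) s) _.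
have : (D * n)%N%:R <= (4 * m)%N%:R :> R by rewrite ler_nat leq_trunc_div.
by rewrite !natrM -addn2 natrD; lra.
Qed.

Theorem theorem55 (R : realType) (k : nat) (hk : (5 <= k)%N) :
  exists G : eograph 'I_k,
    is_complete G /\
    (fun n : nat => (sat_e n (add_extreme_edges G))%:R : R)
      \is 'Omega_\oo (fun n : nat => n%:R * Num.sqrt (ln (n%:R : R))).
Proof.
exists (twisted_graph k); split; first exact: twisted_graph_complete.
(* Once [n] is at least e^64 the root is at least 8, so the term 4n takes at most half of the left
   side. The remaining half is at most 8m, whence 1/16. *)
rewrite qualifE; apply/asboolP; exists 16^-1 => //.
near=> n.
have n_large : expR 64 <= n%:R :> R by near: n; exact: nbhs_infty_ger.
have nR : 0 < n%:R :> R by apply: lt_le_trans n_large; exact: expR_gt0.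
have n0 : (0 < n)%N by rewrite ltr0n in nR.
have sqrt_large : 8 <= Num.sqrt (ln (n%:R : R)).
  rewrite -(ger0_norm (_ : 0 <= 8 :> R)) // -sqrtr_sqr ler_wsqrtr //.
  have : ln (expR (64 : R)) <= ln n%:R by rewrite ler_ln ?posrE ?expR_gt0.
  by rewrite expRK; lra.
have := @sqrt_ln_le R _ _ n0 (@saturated_size _ n (twisted_graph k) _
  (@twisted_graph_complete k) (@twisted_graph_crossing k hk)).
rewrite card_ord => /(_ hk).
rewrite !ger0_norm ?mulr_ge0 ?sqrtr_ge0 ?ler0n // => le_m.
have : n%:R * 8 <= n%:R * Num.sqrt (ln (n%:R : R)) by rewrite ler_pM2l.
lra.
Unshelve. all: by end_near. Qed.
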